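(* Let $\mathcal{P}=\{P_{\alpha,\beta}:\alpha\in A,\ \beta\in B\}$ be a statistical model on $\mathcal{X}$ with parameter of interest $\alpha\in A\subseteq\mathbb{R}^k$ and nuisance parameter $\beta\in B$. Let $\psi:\mathcal{X}\times A\to\mathbb{R}^k$ (not depending on $\beta$) be a regular inference function satisfying the nuisance-uniform unbiasedness condition $$\mathrm{E}_{\alpha,\beta}[\psi(X,\alpha)]=0\qquad\text{for all }(\alpha,\beta)\in A\times B.$$ Then, for each $(\alpha,\beta)$, each component $\psi_i(\cdot,\alpha)$, $i=1,\dots,k$, belongs to the orthogonal complement $\mathcal{T}_N^\perp(\alpha,\beta)$ of the nuisance tangent space $\mathcal{T}_N(\alpha,\beta)$.
   Context: Model: each $P_{\alpha,\beta}$ is represented by a pair $(T_{\alpha,\beta},\varphi)$ with $T_{\alpha,\beta}\in\mathcal{S}'(\mathbb{R})$ a tempered distribution and $\varphi\in\mathcal{S}(\mathbb{R})$ a fixed Schwartz kernel; $\mathcal{A}_\varphi=\{g:g\varphi\in\mathcal{S}(\mathbb{R})\}$, and the weak expectation of $g\in\mathcal{A}_\varphi$ is $\langle T_{\alpha,\beta},g\varphi\rangle$. In the distributional setting the expectations $\mathrm{E}_{\alpha,\beta}$ of functions in $\mathcal{A}_\varphi$ are these pairings. $L^2_0(P)$ denotes the square-integrable, mean-zero functions under $P$, with the $L^2(P)$ inner product; orthogonal complements are taken there. Nuisance tangent space. (Classical case.) When $P_{\alpha,\beta}$ has a density $p(\cdot;\alpha,\beta)$ with scores $\partial_{\beta_j}\log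 p(\cdot;\alpha,\beta)\in L^2_0(P_{\alpha,\beta})$, $$\mathcal{T}_N(\alpha,\beta)=\overline{\operatorname{span}}\{\partial_{\beta_j}\log p(\cdot;\alpha,\beta):j=1,\dots,\dim\beta\}\subset L^2_0(P_{\alpha,\beta}).$$ (Distributional case.) For each nuisance direction $e_j$ let $\dot T_j\in\mathcal{S}'(\mathbb{R})$ be the directional derivative, $\langle\dot T_j,g\varphi\rangle=\lim_{\varepsilon\to0}\varepsilon^{-1}\langle T_{\alpha,\beta+\varepsilon e_j}-T_{\alpha,\beta},g\varphi\rangle$ for all $g\in\mathcal{A}_\varphi$, and let $h_j\in L^2_0(P^{\mathcal{O}}_{\alpha,\beta})$ be its Riesz representative, $\mathrm{E}_{\alpha,\beta}[g(X)h_j(X)]=\langle\dot T_j,g\varphi\rangle$ for all $g\in\mathcal{A}_\varphi$, where $P^{\mathcal{O}}_{\alpha,\beta}$ is the pushforward (observed-data) model, assumed to have a density. Then $\mathcal{T}_N(\alpha,\beta)=\overline{\operatorname{span}}\{h_j:j=1,\dots,\dim\beta\}\subset L^2_0(P^{\mathcal{O}}_{\alpha,\beta})$. The two definitions agree when both are available. Regular inference function: $\psi(\cdot,\alpha)$ is measurable for each $\alpha$, with (R1) admissibility $\psi_i(\cdot,\alpha)\in\mathcal{A}_\varphi$; (R2) unbiasedness (here the nuisance-uniform condition in the claim); (R3) $\alpha\mapsto\mathrm{E}_{\alpha_0,\beta}[\psi(X,\alpha)]$ has a unique zero at the true value $\alpha_0$; and finite variability $\mathrm{E}_{\alpha,\beta}[\psi(X,\alpha)\psi(X,\alpha)^\top]<\infty$,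 so that $\psi_i(\cdot,\alpha)$ lies in the relevant $L^2_0$ space.
   Formalization: In the classical case the claim is false with only pointwise square-integrable scores, so it is also assumed that nuisance derivatives may be taken under the expectation for admissible square-integrable functions, or that the tangent space equals the distributional one. *)

(* Defs.v *)
From HB Require Import structures.
From mathcomp Require Import all_boot all_order all_algebra.
From mathcomp Require Import all_classical all_reals all_analysis.

Set Implicit Arguments.
Unset Strict Implicit.
Unset Printing Implicit Defensive.

Import Order.TTheory GRing.Theory Num.Theory.
Import numFieldNormedType.Exports.

Local Open Scope classical_set_scope.
Local Open Scope ring_scope.

Section Distributions.
Context {R : realType}.
Implicit Types (f g phi : R -> R) (T : (R -> R) -> R).

Definition schwartz f : Prop :=
  (forall (n : nat) (x : R), derivable (f^`(n)%classic) x 1) /\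
  (forall a n : nat, exists C : R, forall x : R, `|x ^+ a * f^`(n)%classic x| <= C).

Definition schwartz_seminorm (a n : nat) f : R :=
  sup [set `|x ^+ a * f^`(n)%classic x| | x in [set: R]].

(* Only the values of [T] on Schwartz functions are meaningful. The topology of
   the Schwartz space is metrizable, so continuity is stated with sequences. *)
Definition tempered T : Prop :=
  (forall (c : R) f g, schwartz f -> schwartz g ->
     T (fun x => c * f x + g x) = c * T f + T g) /\
  (forall (u : nat -> R -> R) f, (forall i, schwartz (u i)) -> schwartz f ->
     (forall a n : nat,
        (fun i => schwartz_seminorm a n (u i \- f)) @ \oo --> (0 : R)) ->
     (fun i => T (u i)) @ \oo --> T f).

Definition admissible phi : set (R -> R) := [set g | schwartz (g \* phi)].

End Distributions.

Section PartialDerivative.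
Context {R : realType} {m : nat}.

(* The steps along the [j]-th coordinate axis that stay in [B]. *)
Definition steps (B : set 'rV[R]_m) (b : 'rV[R]_m) (j : 'I_m) : set_system R :=
  within [set e | B (b + e *: delta_mx 0 j)] 0^'.

(* [B] need not be open, so the difference quotient is taken relatively to [B];
   properness of the filter says that 0 is a limit point of the allowed steps,
   without which every [l] would be a derivative. *)
Definition has_partial (B : set 'rV[R]_m) (F : 'rV[R]_m -> R)
    (b : 'rV[R]_m) (j : 'I_m) (l : R) : Prop :=
  ProperFilter (steps B b j) /\
  (fun e => e^-1 * (F (b + e *: delta_mx 0 j) - F b)) @ steps B b j --> l.

End PartialDerivative.

Section L2.
Context {R : realType} (P : probability (measurableTypeR R) R).
Implicit Types (f g : R -> R) (S : set (R -> R)).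

(* Square-integrable functions are not quotiented by a.e. equality. *)
Definition L20 : set (R -> R) :=
  [set f | f \in Lfun P 2%:E /\ ('E_P[f] = 0)%E].

Definition lin_span {m : nat} (h : 'I_m -> R -> R) : set (R -> R) :=
  [set f | exists c : 'I_m -> R, f = (fun x => \sum_(j < m) c j * h j x)].

Definition L20_closure S : set (R -> R) :=
  [set f | L20 f /\ forall e : R, 0 < e ->
     exists2 g, S g & (Lnorm P 2%:E (EFin \o (f \- g)%R) < e%:E)%E].

Definition L20_orthogonal S : set (R -> R) :=
  [set f | L20 f /\ forall g, S g -> ('E_P[f \* g] = 0)%E].

End L2.

Definition is_density {R : realType}
    (mu : {measure set (measurableTypeR R) -> \bar R})
    (P : probability (measurableTypeR R) R) (p : R -> R) : Prop :=
  [/\ measurable_fun [set: measurableTypeR R] (p : measurableTypeR R -> R),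
      (forall x, 0 <= p x) &
      (forall E : set (measurableTypeR R), measurable E ->
         P E = (\int[mu]_(x in E) (p x)%:E)%E)].

(* [obs_law a b] is the law on R of the (observed) variable X, [tdist a b] the
   tempered distribution. [obs_law_tdist] is what it means for the pair
   ([tdist a b], [skernel]) to represent the law: the weak expectation agrees with
   the ordinary one whenever the latter exists. *)
Record model (R : realType) (k m : nat)
    (A : set 'rV[R]_k) (B : set 'rV[R]_m) := Model {
  obs_law : 'rV[R]_k -> 'rV[R]_m -> probability (measurableTypeR R) R;
  tdist : 'rV[R]_k -> 'rV[R]_m -> (R -> R) -> R;
  skernel : R -> R;
  skernel_schwartz : schwartz skernel;
  tdist_tempered : forall a b, A a -> B b -> tempered (tdist a b);
  obs_law_tdist : forall a b, A a -> B b ->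
    forall g, admissible skernel g -> g \in Lfun (obs_law a b) 1%:E ->
      ('E_(obs_law a b)[g] = (tdist a b (g \* skernel))%:E)%E }.

Section Model.
Context {R : realType} {k m : nat} {A : set 'rV[R]_k} {B : set 'rV[R]_m}.
Variable M : model A B.
Implicit Types (a : 'rV[R]_k) (b : 'rV[R]_m) (h : 'I_m -> R -> R).

Definition weakE a b (g : R -> R) : R := tdist M a b (g \* skernel M).

Record regular_inference (psi : R -> 'rV[R]_k -> 'rV[R]_k) : Prop := {
  inference_measurable : forall a i, A a ->
    measurable_fun [set: measurableTypeR R]
      ((fun x => psi x a 0 i) : measurableTypeR R -> R);
  inference_admissible : forall a i, A a ->
    admissible (skernel M) (fun x => psi x a 0 i);
  inference_zero : forall a0 b a, A a0 -> B b -> A a ->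
    (forall i, weakE a0 b (fun x => psi x a 0 i) = 0) <-> a = a0;
  inference_variance : forall a b i j, A a -> B b ->
    (fun x => psi x a 0 i * psi x a 0 j) \in Lfun (obs_law M a b) 1%:E }.

(* The Riesz identity is only required where its left-hand side makes sense. *)
Definition distributional_scores a b h : Prop :=
  (exists p, is_density lebesgue_measure (obs_law M a b) p) /\
  exists dT : 'I_m -> (R -> R) -> R, forall j,
    [/\ tempered (dT j),
        (forall g, admissible (skernel M) g ->
           has_partial B (fun b' => weakE a b' g) b j (dT j (g \* skernel M))),
        L20 (obs_law M a b) (h j) &
        (forall g, admissible (skernel M) g ->
           (g \* h j) \in Lfun (obs_law M a b) 1%:E ->
           ('E_(obs_law M a b)[g \* h j] = (dT j (g \* skernel M))%:E)%E)].

Definition classical_scores a b h : Prop :=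
  exists (mu : {measure set (measurableTypeR R) -> \bar R})
         (p : 'rV[R]_k -> 'rV[R]_m -> R -> R),
    (forall a' b', A a' -> B b' -> is_density mu (obs_law M a' b') (p a' b')) /\
    forall j, L20 (obs_law M a b) (h j) /\
      {ae obs_law M a b, forall x,
         (\forall e \near steps B b j, 0 < p a (b + e *: delta_mx 0 j) x) /\
         has_partial B (fun b' => ln (p a b' x)) b j (h j x)}.

Definition nuisance_tangent a b h : set (R -> R) :=
  L20_closure (obs_law M a b) (lin_span h).

(* Differentiation under the expectation sign: the classical scores [h j]
   represent the nuisance derivatives of the expectations. *)
Definition score_interchange a b h : Prop :=
  forall j g, admissible (skernel M) g ->
    (forall b', B b' -> g \in Lfun (obs_law M a b') 2%:E) ->
    has_partial B (fun b' => fine 'E_(obs_law M a b')[g]) b j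
      (fine 'E_(obs_law M a b)[g \* h j]).

Definition tangent_agreement a b h : Prop :=
  exists2 h', distributional_scores a b h' &
    nuisance_tangent a b h = nuisance_tangent a b h'.

(* Pointwise existence of square-integrable scores does not by itself control
   the derivatives of the expectations: probability mass may escape to infinity
   along the nuisance direction. *)
Definition regular_classical_scores a b h : Prop :=
  classical_scores a b h /\
  (score_interchange a b h \/ tangent_agreement a b h).

End Model.

(* Main.v *)
(** The expectation of [psi_i(., a)] vanishes at every nuisance value, so its
    derivative in each nuisance direction is zero; this derivative is the inner
    product of [psi_i(., a)] with the corresponding score (Riesz identity in the
    distributional case, differentiation under the expectation in the classical
    one). Orthogonality to the scores extends to their span by linearity and to
    its closure by the Cauchy-Schwarz inequality. *)

Require Import Defs.
From mathcomp Require Import all_boot all_order all_algebra.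
From mathcomp Require Import all_classical all_reals all_analysis.
From mathcomp Require Import measurable_realfun.

Import Order.TTheory GRing.Theory Num.Theory.
Import numFieldNormedType.Exports.

Local Open Scope classical_set_scope.
Local Open Scope ring_scope.

(** Along steps that stay in [B] the difference quotient is identically zero, and properness of
    [steps B b j] makes its limit unique. *)
Lemma has_partial_cst0 (R : realType) (m : nat) (B : set 'rV[R]_m)
    (F : 'rV[R]_m -> R) (b : 'rV[R]_m) (j : 'I_m) (l : R) :
  B b -> (forall b', B b' -> F b' = 0) -> has_partial B F b j l -> l = 0.
Proof.
move=> Bb F0 [PF Fl]; apply: (cvg_unique _ Fl) => //.
apply: (@cvg_near_cst _ _ _ _ _ (within_filter _ _)).
rewrite /steps near_withinE; apply: nearW => e /= Be.
by rewrite !F0// subrr mulr0.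
Qed.

Section L2_orthogonality.
Context {R : realType} (P : probability (measurableTypeR R) R).
Implicit Types (f g : R -> R) (S : set (R -> R)).

Lemma Lfun_measurable (p : \bar R) f : f \in Lfun P p ->
  measurable_fun [set: measurableTypeR R] (f : measurableTypeR R -> R).
Proof. by rewrite inE => /andP[/[!inE]]. Qed.

(** Turns the diagonal case of [inference_variance], an integrability statement about a product,
    into membership in L2. *)
Lemma Lfun2_sqr f :
  measurable_fun [set: measurableTypeR R] (f : measurableTypeR R -> R) ->
  f \* f \in Lfun P 1%:E -> f \in Lfun P 2%:E.
Proof.
move=> mf /Lfun1_integrable/integrableP[_ ff].
apply/andP; split; rewrite !inE//=.
rewrite /finite_norm unlock poweR_lty//; apply: le_lt_trans ff.
rewrite le_eqVlt; apply/orP; left; apply/eqP.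
apply: eq_integral => x _ /=.
by rewrite powR_mulrn// normrM expr2.
Qed.

(** Cauchy-Schwarz, as the case of conjugate exponents 2 and 2 of Hölder's inequality. *)
Lemma abse_expectation_mul_le f g : f \in Lfun P 2%:E -> g \in Lfun P 2%:E ->
  (`|'E_P[f \* g]| <=
     Lnorm P 2%:E (EFin \o f) * Lnorm P 2%:E (EFin \o g))%E.
Proof.
move=> /Lfun_measurable mf /Lfun_measurable mg.
have half1 : (2^-1 + 2^-1 = 1 :> R)%R by rewrite [RHS]splitr !div1r.
apply: le_trans (hoelder P mf mg _ _ half1) => //.
rewrite Lnorm1 unlock; apply: le_abse_integral => //.
by apply/measurable_EFinP; exact: measurable_funM.
Qed.

Lemma expectation_mul_span0 (m : nat) (h : 'I_m -> R -> R) f :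
  f \in Lfun P 2%:E -> (forall j, h j \in Lfun P 2%:E) ->
  (forall j, 'E_P[f \* h j] = 0)%E ->
  forall g, lin_span h g -> g \in Lfun P 2%:E /\ ('E_P[f \* g] = 0)%E.
Proof.
move=> f2 h2 fh0 _ [c ->].
have -> : (fun x => \sum_(j < m) c j * h j x) = \sum_(j < m) (c j \o* h j).
  by apply/funext => x; rewrite fct_sumE; apply: eq_bigr => j _; rewrite mulrC.
(* Square-integrability is carried through the induction because additivity of the expectation
   requires each product with [f] to be integrable. *)
apply: (big_ind (fun u => u \in Lfun P 2%:E /\ ('E_P[f \* u] = 0)%E)).
- split; first exact: Lfun_cst.
  rewrite (_ : f \* 0 = cst 0) ?expectation_cst//.
  by apply/funext => x /=; rewrite mulr0.
- move=> u v [u2 fu0] [v2 fv0]; split.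
    have le12 : (1 <= 2%:E :> \bar R)%E by rewrite lee1n.
    by have [_] := Lfun_addr_closed P le12; exact.
  rewrite (_ : f \* (u + v) = (f \* u) \+ (f \* v)); last first.
    by apply/funext => x /=; rewrite mulrDr.
  by rewrite expectationD ?Lfun2_mul_Lfun1// fu0 fv0 adde0.
- move=> j _; split; first by apply: Lfun_scale => //; rewrite ler1n.
  rewrite (_ : f \* (c j \o* h j) = c j \o* (f \* h j)); last first.
    by apply/funext => x /=; rewrite mulrA.
  by rewrite expectationZl ?Lfun2_mul_Lfun1// fh0 mule0.
Qed.

(** For [s] in [S], the expectation of [f \* g] equals that of [f \* (g \- s)], which Cauchy-Schwarz
    makes as small as desired when [s] approaches [g]. *)
Lemma expectation_mul_closure0 S f :
  f \in Lfun P 2%:E ->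
  (forall g, S g -> g \in Lfun P 2%:E /\ ('E_P[f \* g] = 0)%E) ->
  forall g, L20_closure P S g -> ('E_P[f \* g] = 0)%E.
Proof.
move=> f2 fS0 g [[g2 _] gS].
have Nfin : Lnorm P 2%:E (EFin \o f) \is a fin_num.
  rewrite ge0_fin_numE ?Lnorm_ge0//.
  by move: f2; rewrite inE => /andP[_]; rewrite inE.
apply/eqP; rewrite -abse_eq0 eq_le abse_ge0 andbT.
apply/lee_addgt0Pr => e e0; rewrite add0e.
pose N := fine (Lnorm P 2%:E (EFin \o f)).
have N0 : 0 <= N by rewrite fine_ge0// Lnorm_ge0.
(* The denominator [N + 1] avoids dividing by zero when [f] has norm 0, and still gives
   [N * (e / (N + 1)) <= e]. *)
have [|s Ss gs] := gS (e / (N + 1)); first by rewrite divr_gt0// ltr_wpDl.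
have [s2 fs0] := fS0 _ Ss.
have gs2 : g \- s \in Lfun P 2%:E.
  have le12 : (1 <= 2%:E :> \bar R)%E by rewrite lee1n.
  by have [_] := GRing.submod_closedB (Lfun_submod_closed P le12); exact.
have -> : ('E_P[f \* g] = 'E_P[(f \* (g \- s))%R])%E.
  rewrite (_ : f \* (g \- s) = (f \* g) \- (f \* s)); last first.
    by apply/funext => x /=; rewrite mulrBr.
  by rewrite expectationB ?Lfun2_mul_Lfun1// fs0 sube0.
apply: le_trans (abse_expectation_mul_le _ _ f2 gs2) _.
apply: (@le_trans _ _ (N%:E * (e / (N + 1))%:E)%E).
  by rewrite /N fineK// lee_wpmul2l ?Lnorm_ge0// ltW.
rewrite -EFinM lee_fin mulrCA ler_piMr ?(ltW e0)//.
by rewrite ler_pdivrMr ?ltr_wpDl// mul1r lerDl.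
Qed.

Lemma L20_orthogonal_closure_span (m : nat) (h : 'I_m -> R -> R) f :
  L20 P f -> (forall j, h j \in Lfun P 2%:E) ->
  (forall j, 'E_P[f \* h j] = 0)%E ->
  L20_orthogonal P (L20_closure P (lin_span h)) f.
Proof.
move=> f20 h2 fh0; split=> //; have [f2 _] := f20.
exact/expectation_mul_closure0/expectation_mul_span0.
Qed.

End L2_orthogonality.

(** Unbiasedness is stated for weak expectations. Finite variability gives square-integrability,
    hence integrability under a probability, so [obs_law_tdist] identifies the weak mean with the
    ordinary one. *)
Lemma regular_inference_L20 (R : realType) (k m : nat)
    (A : set 'rV[R]_k) (B : set 'rV[R]_m) (M : model A B)
    (psi : R -> 'rV[R]_k -> 'rV[R]_k) (a : 'rV[R]_k) (b : 'rV[R]_m) (i : 'I_k) :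
  regular_inference M psi -> A a -> B b ->
  weakE M a b (fun x => psi x a 0 i) = 0 ->
  L20 (obs_law M a b) (fun x => psi x a 0 i).
Proof.
move=> [mpsi apsi _ vpsi] Aa Bb E0.
have psi2 := Lfun2_sqr _ _ (mpsi a i Aa) (vpsi a b i i Aa Bb).
split=> //; rewrite (obs_law_tdist Aa Bb)//.
- by rewrite -/(weakE M a b _) E0.
- exact: apsi.
- by apply: Lfun_subset12 => //; exact: fin_num_measure.
Qed.

Theorem proposition8p1 (R : realType) (k m : nat)
    (A : set 'rV[R]_k) (B : set 'rV[R]_m) (M : model A B)
    (psi : R -> 'rV[R]_k -> 'rV[R]_k)
    (psi_regular : regular_inference M psi)
    (psi_unbiased : forall a b, A a -> B b ->
       forall i : 'I_k, weakE M a b (fun x => psi x a 0 i) = 0) :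
  forall (a : 'rV[R]_k) (b : 'rV[R]_m), A a -> B b ->
  forall h : 'I_m -> R -> R,
    distributional_scores M a b h \/ regular_classical_scores M a b h ->
  forall i : 'I_k,
    L20_orthogonal (obs_law M a b) (nuisance_tangent M a b h) (fun x => psi x a 0 i).
Proof.
move=> a b Aa Bb h scores i.
(* Kept for every [b'] in [B]: the interchange of derivative and expectation needs [f]
   square-integrable and centred at all nuisance values. *)
have f20 := fun b' Bb' =>
  regular_inference_L20 _ _ _ _ _ M psi a b' i psi_regular Aa Bb' (psi_unbiased a b' Aa Bb' i).
have f_adm := inference_admissible psi_regular i Aa.
set f : R -> R := fun x => psi x a 0 i in f20 f_adm *.
have [f2 _] := f20 b Bb.
have dist_orth h' : distributional_scores M a b h' ->
    L20_orthogonal (obs_law M a b) (nuisance_tangent M a b h') f.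
  move=> [_ [dT dTP]]; apply: L20_orthogonal_closure_span => // [|j|j].
  - exact: f20.
  - by have [_ _ []] := dTP j.
  - have [_ fdT [h2 _] riesz] := dTP j.
    (* The Riesz identity is tested on [f] itself; the product of two L2 functions is integrable, as
       its side condition demands. *)
    rewrite (riesz f f_adm (Lfun2_mul_Lfun1 f2 h2)).
    rewrite (has_partial_cst0 _ _ _ _ _ _ _ Bb _ (fdT f f_adm))// => b' Bb'.
    exact: psi_unbiased.
(* Under [tangent_agreement] the classical tangent space equals a distributional one, so only the
   interchange case remains. *)
case: scores => [/dist_orth//|[[mu [p [_ hP]]] [swap|[h' /dist_orth + ->//]]]].
apply: L20_orthogonal_closure_span => // [|j|j].
- exact: f20.
- by have [[]] := hP j.
- have [[h2 _] _] := hP j.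
  have f2B b' : B b' -> f \in Lfun (obs_law M a b') 2%:E by case/f20.
  (* The interchange speaks of real derivatives through [fine], so finiteness of the expectation is
     needed to pass to it. *)
  rewrite -[LHS]fineK ?(expectation_fin_num (Lfun2_mul_Lfun1 f2 h2))//.
  rewrite (has_partial_cst0 _ _ _ _ _ _ _ Bb _ (swap j f f_adm f2B))// => b'.
  by case/f20 => _ ->.
Qed.
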